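(* The set of Borel codes of learnable Borel equivalence relations on Cantor space $2^\omega$ is $\Pi^1_1$ (as a subset of $2^\omega$).
   Context: A Borel code is a labeled tree $T\subseteq\omega^{<\omega}$ whose leaves are labeled by codes for elements of a fixed countable subbase of $2^\omega\times 2^\omega$ and whose internal nodes are labeled by $\cup$ or $\cap$ (the set coded by a node is the union, resp. intersection, of the sets coded by its children); labeled trees are identified with elements of $2^\omega$. An equivalence relation $E$ on $2^\omega$ is learnable if there are continuous functions $l_n:(2^\omega)^\omega\times 2^\omega\to\omega$ ($\omega$ discrete) such that for all $x$ and $\vec x=(x_i)_{i\in\omega}$, if $x\mathrel{E}x_i$ for some $i$, then $L=\lim_n l_n(\vec x,x)$ exists and $x\mathrel{E}x_L$. *)

(* Defs.v *)
From mathcomp Require Import all_boot.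
From mathcomp Require Import boolp classical_sets topology cantor.
From Stdlib Require Import RelationClasses.

Set Implicit Arguments.
Unset Strict Implicit.
Unset Printing Implicit Defensive.

Local Open Scope classical_set_scope.

(* Number variables are de Bruijn indices, looked up in a list. *)
Inductive term :=
  | TVar of nat
  | TZero
  | TSucc of term
  | TAdd of term & term
  | TMul of term & term.

(* Formulas without set quantifiers; [FIn t i] is "t belongs to the set X_i". *)
Inductive arith_formula :=
  | FEq of term & term
  | FLt of term & term
  | FIn of term & nat
  | FNot of arith_formula
  | FAnd of arith_formula & arith_formula
  | FAll of arith_formula.

Fixpoint eval (e : seq nat) (t : term) : nat :=
  match t with
  | TVar i => nth 0 e i
  | TZero => 0
  | TSucc t => (eval e t).+1
  | TAdd t u => eval e t + eval e u
  | TMul t u => eval e t * eval e u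
  end.

(* A variable outside its environment denotes 0, resp. the empty set; both are
   definable without parameters, so this does not enlarge the definable sets. *)
Fixpoint sat (X : seq cantor_space) (e : seq nat) (phi : arith_formula) : Prop :=
  match phi with
  | FEq t u => eval e t = eval e u
  | FLt t u => eval e t < eval e u
  | FIn t i => nth (fun=> false) X i (eval e t)
  | FNot phi => ~ sat X e phi
  | FAnd phi psi => sat X e phi /\ sat X e psi
  | FAll phi => forall n : nat, sat X (n :: e) phi
  end.

(* Lightface Pi^1_1: A is defined in second-order arithmetic by
   "forall X_1 ... X_k, phi(x, X_1, ..., X_k)" with phi arithmetical and
   without parameters; x is the set variable of index 0. *)
Definition Pi11 (A : set cantor_space) : Prop :=
  exists (k : nat) (phi : arith_formula), forall x : cantor_space,
    A x <-> forall X : k.-tuple cantor_space, sat (x :: X) [::] phi.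

(* [Basic snd_coord n b] stands for the subbasic clopen set of the (x, y) in
   2^omega * 2^omega such that x n = b (if snd_coord is false) or y n = b
   (if snd_coord is true). *)
Variant label := Cup | Cap | Basic of bool & nat & bool.

Definition subbasic (snd_coord : bool) (n : nat) (b : bool) :
    set (cantor_space * cantor_space) :=
  [set z | (if snd_coord then z.2 else z.1) n = b].

(* A bijection. *)
Definition label_code (l : label) : nat :=
  match l with
  | Cup => 0
  | Cap => 1
  | Basic snd_coord n b => 2 + (4 * n + 2 * snd_coord + b)
  end.

(* A tree T of finite sequences together with its labelling; the nodes are the
   s with T s <> None, and the children of s are the nodes rcons s k. *)
Definition labeled_tree := seq nat -> option label.

Definition node (T : labeled_tree) (s : seq nat) : Prop := T s <> None.

Definition leaf (T : labeled_tree) (s : seq nat) : Prop :=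
  node T s /\ forall k, ~ node T (rcons s k).

Definition leaf_label (l : label) : bool :=
  if l is Basic _ _ _ then true else false.

Record borel_code (T : labeled_tree) : Prop := BorelCode {
  borel_code_root : node T [::];
  borel_code_prefix : forall s k, node T (rcons s k) -> node T s;
  borel_code_label : forall s l, T s = Some l -> leaf_label l <-> leaf T s;
  borel_code_wf : forall f : nat -> nat, exists n, ~ node T (mkseq f n)
}.

(* The set coded by the node s. The recursion along T is monotone, so it can be
   written as an inductive predicate; as a Borel code is well founded, its only
   solution is this least one. *)
Inductive node_set (T : labeled_tree) (z : cantor_space * cantor_space) :
    seq nat -> Prop :=
  | node_set_basic s snd_coord n b :
      T s = Some (Basic snd_coord n b) -> subbasic snd_coord n b z ->
      node_set T z s
  | node_set_cup s k :
      T s = Some Cup -> node T (rcons s k) -> node_set T z (rcons s k) ->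
      node_set T z s
  | node_set_cap s :
      T s = Some Cap ->
      (forall k, node T (rcons s k) -> node_set T z (rcons s k)) ->
      node_set T z s.

Definition coded_rel (T : labeled_tree) (x y : cantor_space) : Prop :=
  node_set T (x, y) [::].

(* The labelled tree as an element of 2^omega: the characteristic function of
   the graph of the labelling, the pair (s, l) being represented by
   CodeSeq.code (label_code l :: s). CodeSeq.code is a bijection from seq nat to
   nat, so this is injective. *)
Definition encode (T : labeled_tree) : cantor_space :=
  fun m => if CodeSeq.decode m is k :: s then omap label_code (T s) == Some k
           else false.

Local Notation cantor_seq := (prod_topology (fun _ : nat => cantor_space)).

(* nat carries the discrete topology. *)
Definition learnable (E : cantor_space -> cantor_space -> Prop) : Prop :=
  exists l : nat -> cantor_seq * cantor_space -> nat,
    (forall n, continuous (l n)) /\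
    forall (xs : cantor_seq) (x : cantor_space),
      (exists i, E x (xs i)) ->
      exists L : nat, (l n (xs, x) @[n --> \oo] --> L) /\ E x (xs L).

(* Main.v *)
(** A learnable equivalence relation is F_sigma, and conversely, so the task is to
    express "E is F_sigma" by a Pi^1_1 formula in a code of E.  Membership in E is
    certified by a set of nodes v, and the triples (x, y, v) with v a certificate
    for E x y form a G_delta set; non-membership is certified likewise.  Removing
    from this G_delta set the basic open sets whose projections are covered by
    countably many closed subsets of E shows that E fails to be F_sigma iff there
    are certified triples p_i and pairs b_t certified not to be in E such that
    every neighbourhood of every p_i contains p_j's whose projections converge to
    some b_t.  That the p_i and b_t have these properties is arithmetical.  By the
    Baire category theorem, their existence directly refutes learnability. *)

Require Import Defs.
From mathcomp Require Import all_boot.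
From mathcomp Require Import boolp classical_sets topology cantor.
From Stdlib Require Import RelationClasses.
From mathcomp Require Import mathcomp_extra zify.

Set Implicit Arguments.
Unset Strict Implicit.
Unset Printing Implicit Defensive.

Local Open Scope classical_set_scope.

(** * Cantor space through finite approximations *)

Definition agree T n (p q : nat -> T) := forall m, m < n -> p m = q m.

Lemma agree_sym T n (p q : nat -> T) : agree n p q -> agree n q p.
Proof. by move=> pq m /pq. Qed.

Lemma agree_trans T n (p q r : nat -> T) :
  agree n p q -> agree n q r -> agree n p r.
Proof. by move=> pq qr m mn; rewrite pq // qr. Qed.

Lemma agree_le T m n (p q : nat -> T) : m <= n -> agree n p q -> agree m p q.
Proof. by move=> mn pq i im; apply: pq; apply: leq_trans mn. Qed.

Lemma agree_mkseqP T n (p q : nat -> T) :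
  mkseq p n = mkseq q n <-> agree n p q.
Proof.
split=> [pq m mn|pq]; first by rewrite -(nth_mkseq (p 0) p mn) pq nth_mkseq.
by apply/eq_in_map => m; rewrite mem_iota => /pq.
Qed.

Local Notation cantor_seq := (prod_topology (fun _ : nat => cantor_space)).

Lemma cvg_pointwise (T : topologicalType)
    (u : nat -> prod_topology (fun _ : nat => T))
    (x : prod_topology (fun _ : nat => T)) :
  (forall i, u n i @[n --> \oo] --> x i) -> u n @[n --> \oo] --> x.
Proof.
move=> ux; apply/cvg_sup => i.
have prj : @proj nat (fun=> T) i @` setT = setT.
  by rewrite eqEsubset; split=> // y _; exists (fun=> y).
apply/cvg_image => // B Bx; exists (proj i @^-1` B); first exact: ux Bx.
exact: image_preimage.
Qed.

Lemma cvg_natP (u : nat -> nat) (L : nat) :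
  u n @[n --> \oo] --> L <-> exists N, forall n, N <= n -> u n = L.
Proof.
split=> [uL|[N uN]].
  have [N _ uN] := uL _ (discrete_set1 (L : nat)).
  by exists N => n Nn; apply: uN.
by move=> A /nbhs_singleton AL; exists N => // n Nn; rewrite /preimage /= uN.
Qed.

Lemma near_agree (x : cantor_space) N : \forall y \near x, agree N x y.
Proof.
elim: N => [|N IH]; first exact: filterE.
have : \forall y \near x, y N = x N.
  have := @proj_continuous nat (fun=> bool) N x [set x N].
  by apply; apply: discrete_set1.
move: IH; apply: filterS2 => y xy yN m; rewrite ltnS leq_eqVlt.
by case/orP=> [/eqP ->|/xy].
Qed.

(** These are the basic neighbourhoods of the product: one bound truncates both the list and each
    point in it. *)
Definition agree2 N (z z' : cantor_seq * cantor_space) :=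
  agree N z.2 z'.2 /\ forall i, i < N -> agree N (z.1 i) (z'.1 i).

Lemma near_agree2 (z : cantor_seq * cantor_space) N :
  \forall z' \near z, agree2 N z z'.
Proof.
case: z => xs x; have Fxs : Filter (nbhs xs) by apply: nbhs_filter.
have H M : \forall ys \near xs, forall i, i < M -> agree N (xs i) (ys i).
  elim: M => [|M IH]; first by apply: filterE => ys i.
  have : \forall ys \near xs, agree N (xs M) (ys M).
    exact: (@proj_continuous nat (fun=> cantor_space) M xs
              [set y | agree N (xs M) y]) (near_agree _ _).
  move: IH; apply: filterS2 => y xy yN m; rewrite ltnS leq_eqVlt.
  by case/orP=> [/eqP ->|/xy].
exists ([set ys | forall i, i < N -> agree N (xs i) (ys i)],
        [set y | agree N x y]).
  by split; [apply: H | apply: near_agree].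
by move=> [ys y] [].
Qed.

Lemma cvg_agree (u : nat -> cantor_space) (x : cantor_space) :
  (forall n, agree n x (u n)) -> u n @[n --> \oo] --> x.
Proof.
move=> xu; apply: cvg_pointwise => i; apply: cvg_near_cst.
by exists i.+1 => // n /= iN; rewrite (xu n).
Qed.

(** If no [N] works at [z], counterexamples agreeing with [z] up to [n] form a sequence that tends
    to [z]; as [nat] is discrete, [g] would eventually equal [g z] along it. *)
Lemma continuous_agree2P (g : cantor_seq * cantor_space -> nat) :
  continuous g <-> forall z, exists N, forall z', agree2 N z z' -> g z' = g z.
Proof.
split=> [cg z|lg z].
  apply: contrapT => /forallNP H.
  have {}H N : exists z', agree2 N z z' /\ g z' <> g z.
    have /existsNP[z' /not_implyP Hz'] := H N.
    by exists z'.
  have [u Hu] := choice H.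
  have uz : u n @[n --> \oo] --> z.
    have u1 : (u n).1 @[n --> \oo] --> z.1.
      apply: cvg_pointwise => i; apply: (cvg_pointwise (T := bool)) => m.
      apply: cvg_near_cst; exists (i + m).+1 => // n /= Nn.
      have [[_ Hn] _] := Hu n.
      by rewrite (Hn i) //; lia.
    have u2 : (u n).2 @[n --> \oo] --> z.2.
      by apply: cvg_agree => n; case: (Hu n) => -[].
    move=> A [[P Q] [/= Pz Qz] PQA].
    have [N1 _ P1] := u1 P Pz; have [N2 _ P2] := u2 Q Qz.
    by exists (N1 + N2) => // n /= Nn; apply: PQA; split; [apply: P1 | apply: P2];
      rewrite /=; lia.
  have /cvg_natP[N /(_ N (leqnn N)) gN] := cvg_trans (cvg_app g uz) (cg z).
  by case: (Hu N).
have [N HN] := lg z => A /nbhs_singleton Agz.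
by apply: filterS (near_agree2 z N) => z' /HN /= ->.
Qed.

(** * Learnability refuted by Baire category *)

Definition open_pred T (A : (nat -> T) -> Prop) :=
  forall p, A p -> exists N, forall q, agree N p q -> A q.

Definition closed_pred T (C : (nat -> T) -> Prop) :=
  forall q, (forall n, exists p, agree n q p /\ C p) -> C q.

Lemma closed_predN T (C : (nat -> T) -> Prop) q :
  closed_pred C -> ~ C q -> exists N, forall p, agree N q p -> ~ C p.
Proof.
move=> clC nCq; apply: contrapT => /forallNP H; apply/nCq/clC => n.
by have /existsNP[p /not_implyP[qp /contrapT Cp]] := H n; exists p.
Qed.

(* The p_i are dense in a subspace of the G_delta set cut out by D; if closed
   sets C cover that subspace near p_i0, one of them has interior. *)
Lemma baire_dense_family T (J K : countType) (D : J -> (nat -> T) -> Prop)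
    (C : K -> (nat -> T) -> Prop) (p : nat -> nat -> T) i0 n0 :
  (forall j, open_pred (D j)) -> (forall c, closed_pred (C c)) ->
  (forall i j, D j (p i)) ->
  (forall q, (forall j, D j q) -> agree n0 (p i0) q ->
     (forall n, exists i, agree n q (p i)) -> exists c, C c q) ->
  exists i n c, [/\ n0 <= n, agree n0 (p i0) (p i) &
    forall j, agree n (p i) (p j) -> C c (p j)].
Proof.
move=> oD clC Dp cover; apply: contrapT => nH.
have {nH} H i n c : n0 <= n -> agree n0 (p i0) (p i) ->
    exists j, agree n (p i) (p j) /\ ~ C c (p j).
  move=> n0n ag; apply: contrapT => /forallNP nj; apply: nH.
  exists i, n, c; split=> // j agj; apply: contrapT => nC.
  exact: (nj j).
(* A state [(i, n)] stands for the basic open set of length [n] around [p i]. Stage [m] shrinks it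
   so as to avoid the [m]-th closed set and to enter the [m]-th open set. *)
pose step_spec (m : nat) (s s' : nat * nat) :=
  [/\ s.2 < s'.2, agree s.2 (p s.1) (p s'.1),
      forall c, unpickle m = Some c ->
        forall q, agree s'.2 (p s'.1) q -> ~ C c q &
      forall j, unpickle m = Some j ->
        forall q, agree s'.2 (p s'.1) q -> D j q].
(* Guarding by the invariant makes the relation total, as choice requires; [(0, 0)] is a dummy value
   for the other states. *)
have step (ms : nat * (nat * nat)) : exists s',
    n0 <= ms.2.2 -> agree n0 (p i0) (p ms.2.1) -> step_spec ms.1 ms.2 s'.
  case: ms => m [i n] /=.
  have [/andP[n0n /asboolP ag]|] :=
    boolP ((n0 <= n) && `[< agree n0 (p i0) (p i) >]); last first.
    by move=> nag; exists (0, 0) => n0n ag; rewrite n0n asboolT in nag.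
  have [i' [agi' [N1 HN1]]] : exists i', agree n (p i) (p i') /\
      exists N, forall c, unpickle m = Some c ->
        forall q, agree N (p i') q -> ~ C c q.
    case Em: (unpickle m : option K) => [c|]; last by exists i; split=> //; exists 0.
    have [i' [agi' nC]] := H i n c n0n ag.
    have [N HN] := closed_predN (clC c) nC.
    by exists i'; split=> //; exists N => _ [<-].
  have [N2 HN2] : exists N, forall j, unpickle m = Some j ->
      forall q, agree N (p i') q -> D j q.
    case Em: (unpickle m : option J) => [j|]; last by exists 0.
    have [N HN] := oD j _ (Dp i' j).
    by exists N => _ [<-].
  exists (i', (n + N1 + N2).+1) => _ _; split=> //=; first lia.
    by move=> c mc q qp; apply: (HN1 c mc); apply: agree_le qp; lia.
  by move=> j mj q qp; apply: (HN2 j mj); apply: agree_le qp; lia.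
have [st Hst] := choice step.
pose S := fix S m := if m is m'.+1 then st (m', S m') else (i0, n0).
have Sinv m : n0 <= (S m).2 /\ agree n0 (p i0) (p (S m).1).
  elim: m => [|m [IH1 IH2]] //.
  have [lt ag _ _] : step_spec m (S m) (S m.+1) by apply: (Hst (m, S m)).
  by split; [lia | apply: (agree_trans IH2); apply: agree_le ag].
have Sst m : step_spec m (S m) (S m.+1).
  by have [IH1 IH2] := Sinv m; apply: (Hst (m, S m)).
have S_ge m : m <= (S m).2.
  by elim: m => // m IH; have [lt _ _ _] := Sst m; lia.
have S_ag m d : (S m).2 <= (S (m + d)).2 /\
    agree (S m).2 (p (S m).1) (p (S (m + d)).1).
  elim: d => [|d [IH1 IH2]]; first by rewrite addn0.
  rewrite addnS; have [lt ag _ _] := Sst (m + d).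
  by split; [lia | apply: (agree_trans IH2); apply: agree_le ag].
(* The limit of the shrinking sets: coordinate [k] is settled by stage [k.+1], whose length exceeds
   [k]. *)
pose q k := p (S k.+1).1 k.
have agq m : agree (S m).2 (p (S m).1) q.
  move=> k km; rewrite /q; have [mk|km1] := leqP m k.+1.
    have [_] := S_ag m (k.+1 - m); rewrite subnKC //; exact.
  have [_] := S_ag k.+1 (m - k.+1); rewrite subnKC; last lia.
  by move=> ->//; apply: S_ge.
have Dq j : D j q.
  have [_ _ _ Hj] := Sst (pickle j).
  by apply: (Hj j) (agq _); rewrite pickleK.
have [c Cq] : exists c, C c q.
  apply: cover => //; first exact: (agq 0).
  by move=> n; exists (S n).1; apply/agree_sym/(agree_le (S_ge n))/agq.
have [_ _ Hc _] := Sst (pickle c).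
by apply: (Hc c _ q) Cq; rewrite ?pickleK.
Qed.

Definition fst_seq (z : nat -> bool * bool) : cantor_space := fun m => (z m).1.
Definition snd_seq (z : nat -> bool * bool) : cantor_space := fun m => (z m).2.
Definition zip_seq T U (x : nat -> T) (y : nat -> U) m := (x m, y m).
(** A point of [nat -> bool * bool * bool] is a triple (x, y, v) of sequences, v being a
    certificate; this is the projection that forgets v. *)
Definition base (p : nat -> bool * bool * bool) m := (p m).1.

Lemma agree_base n p q : agree n p q -> agree n (base p) (base q).
Proof. by move=> pq m mn; rewrite /base pq. Qed.

Definition stable (l : nat -> cantor_seq * cantor_space -> nat) (NL : nat * nat)
  z := forall n, NL.1 <= n -> l n z = NL.2.

Lemma learnableP (E : cantor_space -> cantor_space -> Prop) : learnable E <->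
  exists l : nat -> cantor_seq * cantor_space -> nat,
    (forall n z, exists N, forall z', agree2 N z z' -> l n z' = l n z) /\
    forall z, (exists i, E z.2 (z.1 i)) ->
      exists N L, stable l (N, L) z /\ E z.2 (z.1 L).
Proof.
split=> -[l [cl ll]]; exists l; split.
- by move=> n; apply/continuous_agree2P.
- case=> xs x /ll[L [/cvg_natP[N HN] EL]].
  by exists N, L.
- by move=> n; apply/continuous_agree2P.
- move=> xs x /(ll (xs, x))[N [L [HN EL]]].
  by exists L; split=> //; apply/cvg_natP; exists N.
Qed.

Lemma stable_unique l N L N' L' z :
  stable l (N, L) z -> stable l (N', L') z -> L = L'.
Proof.
by move=> /(_ (N + N') (leq_addr _ _)) /= <- /(_ (N + N') (leq_addl _ _)).
Qed.

Definition lipschitz T (g : (nat -> T) -> cantor_seq * cantor_space) :=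
  forall M q p, agree M q p -> agree2 M (g q) (g p).

(** For each n, the condition that [l n] takes the value [NL.2] is clopen, and its pullback along
    [g] is clopen again; stability is an intersection of such conditions. *)
Lemma closed_stable T l (g : (nat -> T) -> cantor_seq * cantor_space) NL :
  (forall n z, exists N, forall z', agree2 N z z' -> l n z' = l n z) ->
  lipschitz g -> closed_pred (fun q => stable l NL (g q)).
Proof.
move=> cl lg q cq n Nn; have [M HM] := cl n (g q).
have [p [qp sp]] := cq M.
by rewrite -(sp n Nn); apply/esym/HM/lg.
Qed.

Definition cons_seq T (a : T) (u : nat -> T) i := if i is i'.+1 then u i' else a.

Section Unlearnable.
Variables (E : cantor_space -> cantor_space -> Prop) (J : countType).
Variables (D : J -> (nat -> bool * bool * bool) -> Prop).
Variables (p : nat -> nat -> bool * bool * bool) (b : nat -> nat -> bool * bool).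
Hypothesis E_equiv : Equivalence E.
Hypothesis D_open : forall j, open_pred (D j).
Hypothesis D_E : forall q, (forall j, D j q) ->
  E (fst_seq (base q)) (snd_seq (base q)).
Hypothesis p_D : forall i j, D j (p i).
Hypothesis b_notE : forall t, ~ E (fst_seq (b t)) (snd_seq (b t)).
Hypothesis b_limit : forall i n, exists t, forall k, exists j,
  agree n (p i) (p j) /\ agree k (b t) (base (p j)).

(** Baire category makes the answer constant on all [p j] near some [p i]. Closedness then carries
    it over to limits [z] of the projections of these [p j], even when [z] is outside [E], as the
    [b t] are. *)
Lemma stable_near l (g : (nat -> bool * bool) -> cantor_seq * cantor_space) i0 n0 :
  (forall n z, exists N, forall z', agree2 N z z' -> l n z' = l n z) ->
  lipschitz g ->
  (forall q, (forall j, D j q) -> agree n0 (p i0) q ->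
     (forall n, exists i, agree n q (p i)) ->
     exists NL, stable l NL (g (base q))) ->
  exists i n NL, [/\ n0 <= n, agree n0 (p i0) (p i) &
    forall z, (forall k, exists j, agree n (p i) (p j) /\ agree k z (base (p j))) ->
      stable l NL (g z)].
Proof.
move=> cl lg cover.
have [|i [n [NL [n0n ag H]]]] := baire_dense_family (i0 := i0) (n0 := n0)
    (C := fun NL q => stable l NL (g (base q))) D_open _ p_D cover.
  move=> NL; apply: closed_stable => // M q q' /agree_base; exact: lg.
exists i, n, NL; split=> // z Hz; apply: (closed_stable cl lg) => k.
by have [j [/H st agz]] := Hz k; exists (base (p j)).
Qed.

(* First feed the learner x and (y, u_0, u_1, ...), where (u_t, w_t) = b_t; it is
   eventually constant near some p_i. The index 0 would put some b_t into E, so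
   the x's near p_i all lie in the class of one u. Then feed it y and
   (u, w_0, w_1, ...): any constant answer puts some w_t into the class of u. *)
Lemma witness_not_learnable : ~ learnable E.
Proof.
have [Er Es Et] := E_equiv.
move=> /learnableP[l [cl ll]].
have ll' N L z : (exists i, E z.2 (z.1 i)) -> stable l (N, L) z -> E z.2 (z.1 L).
  by move=> /ll[N' [L' [st' EL']]] st; rewrite (stable_unique st st').
pose u t := fst_seq (b t); pose w t := snd_seq (b t).
pose g z : cantor_seq * cantor_space := (cons_seq (snd_seq z) u, fst_seq z).
have lg : lipschitz g.
  move=> M q q' qq'; split=> [m mM|[|i] iM m mM] //=.
    by rewrite /fst_seq qq'.
  by rewrite /snd_seq qq'.
have [q Dq _ _|i0 [n0 [[N L] [_ _ st]]]] := stable_near (i0 := 0) (n0 := 0) cl lg.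
  have [|N [L [st _]]] := ll (g (base q)); last by exists (N, L).
  by exists 0; apply: D_E.
have near_p i : agree n0 (p i0) (p i) -> stable l (N, L) (g (base (p i))).
  by move=> ag; apply: st => k; exists i.
have near_lim q : agree n0 (p i0) q -> (forall n, exists i, agree n q (p i)) ->
    stable l (N, L) (g (base q)).
  move=> ag lim; apply: st => k; have [i agi] := lim (k + n0).
  exists i; split; last by apply/agree_base/(agree_le _ agi); lia.
  by apply: (agree_trans ag); apply: (agree_le _ agi); lia.
(* In [g (b t)] the point [u t] is itself entry [t.+1] of the list, so the learner has to answer
   correctly there, although [b t] is not in [E]. *)
have near_b i n t : n0 <= n -> agree n0 (p i0) (p i) ->
    (forall k, exists j, agree n (p i) (p j) /\ agree k (b t) (base (p j))) ->
    E (u t) (cons_seq (w t) u L).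
  move=> n0n ag Ht; apply: (ll' N L (g (b t))); first by exists t.+1; apply: Er.
  apply: st => k; have [j [agj bj]] := Ht k; exists j; split=> //.
  by apply: (agree_trans ag); apply: agree_le agj.
case: L st near_p near_lim near_b => [|t0] st near_p near_lim near_b.
  have [t Ht] := b_limit i0 n0.
  by apply: (b_notE (t := t)); apply: (near_b i0 n0).
pose g2 z : cantor_seq * cantor_space := (cons_seq (u t0) w, snd_seq z).
have lg2 : lipschitz g2.
  move=> M q q' qq'; split=> [m mM|[|i] iM m mM] //=.
  by rewrite /snd_seq qq'.
have Eu q : (forall j, D j q) -> agree n0 (p i0) q ->
    (forall n, exists i, agree n q (p i)) -> E (snd_seq (base q)) (u t0).
  move=> Dq ag lim; apply: (Et _ (fst_seq (base q))); first exact/Es/D_E.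
  apply: (ll' N t0.+1 (g (base q)) _ (near_lim _ ag lim)).
  by exists 0; apply: D_E.
have [q Dq ag lim|i1 [n1 [[N' L'] [n01 ag st2]]]] :=
    stable_near (i0 := i0) (n0 := n0) cl lg2.
  have [|M [L [stq _]]] := ll (g2 (base q)); last by exists (M, L).
  by exists 0; apply: Eu.
have [t Ht] := b_limit i1 n1.
have ut : E (u t) (u t0) by apply: (near_b i1 n1).
have nwt : ~ E (w t) (u t0).
  by move=> wt; apply: (@b_notE t); apply: (Et _ _ _ ut (Es _ _ wt)).
have wt : E (w t) (cons_seq (u t0) w L').
  apply: (ll' N' L' (g2 (b t))); first by exists t.+1; apply: Er.
  exact: st2.
case: L' st2 wt => [|t1] st2 wt //.
(* With answer [t1.+1], the y of [p i1] is related to both [u t0] and [w t1], which links [w t] to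
   [u t0] and contradicts [nwt]. *)
have yu : E (snd_seq (base (p i1))) (u t0) by apply: Eu => // n; exists i1.
have yw : E (snd_seq (base (p i1))) (w t1).
  apply: (ll' N' t1.+1 (g2 (base (p i1)))); first by exists 0.
  by apply: st2 => k; exists i1.
by apply/nwt/(Et _ _ _ wt)/(Et _ _ _ _ yu)/Es.
Qed.

End Unlearnable.

(** * Learnability of F_sigma relations *)

Lemma agree2_zip N z z' i n :
  agree2 N z z' -> i < N -> n <= N ->
  agree n (zip_seq z.2 (z.1 i)) (zip_seq z'.2 (z'.1 i)).
Proof.
by move=> [H2 H1] iN nN m mn; rewrite /zip_seq H2 ?(H1 i) //; lia.
Qed.

Lemma uniform_bound (P : nat -> nat -> Prop) n :
  (forall e, e < n -> exists N, forall m, N <= m -> P e m) ->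
  exists N, forall m, N <= m -> forall e, e < n -> P e m.
Proof.
elim: n => [|n IH] H; first by exists 0.
have [|N1 H1] := IH; first by move=> e en; apply: H; lia.
have [N2 H2] := H n (leqnn _).
exists (N1 + N2) => m Nm e; rewrite ltnS leq_eqVlt => /orP[/eqP ->|en].
  by apply: H2; lia.
by apply: H1 => //; lia.
Qed.

(* The learner guesses the least pair (i, m), in some enumeration, for which
   "(x, x_i) is in F_m" has not been refuted yet. *)
Lemma fsigma_learnable (E : cantor_space -> cantor_space -> Prop)
    (F : nat -> (nat -> bool * bool) -> Prop) :
  (forall m, closed_pred (F m)) ->
  (forall x y, E x y <-> exists m, F m (zip_seq x y)) -> learnable E.
Proof.
move=> clF EF; apply/learnableP.
pose cand n (z : cantor_seq * cantor_space) e :=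
  if unpickle e is Some im then
    `[< exists z', agree n (zip_seq z.2 (z.1 im.1)) z' /\ F im.2 z' >]
  else false.
pose idx e := if unpickle e is Some im then (im : nat * nat).1 else 0.
exists (fun n z => idx (find (cand n z) (iota 0 n))); split=> [n z|z [i Ei]].
  (* The agreement has to reach every list entry mentioned by the finitely many codes below [n]. *)
  have [N HN] : exists N, forall m, N <= m -> forall e, e < n -> idx e < m.
    by apply: uniform_bound => e _; exists (idx e).+1.
  exists (n + N) => z' zz'; congr idx; apply: eq_in_find => e.
  rewrite mem_iota => /andP[_ en]; rewrite /cand.
  have := HN (n + N) (leq_addl _ _) e en.
  rewrite /idx; case: (unpickle e) => // im iN; apply: asbool_equiv_eq.
  have ag : agree n (zip_seq z.2 (z.1 im.1)) (zip_seq z'.2 (z'.1 im.1)).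
    by apply: (agree2_zip zz') => //; lia.
  split=> -[y [agy Fy]]; exists y; split=> //.
    exact: agree_trans ag agy.
  exact: agree_trans (agree_sym ag) agy.
pose full e := if unpickle e is Some im then `[< F im.2 (zip_seq z.2 (z.1 im.1)) >]
  else false.
have ex_full : exists e, full e.
  have [m Fm] := (EF _ _).1 Ei.
  by exists (pickle (i, m)); rewrite /full pickleK; apply/asboolP.
case: (ex_minnP ex_full) => e fe emin.
(* A code below the least correct one is wrong, and being outside a closed set shows at a finite
   stage. *)
have [N HN] : exists N, forall n, N <= n -> forall e', e' < e -> ~~ cand n z e'.
  apply: uniform_bound => e' lte.
  have : ~~ full e' by apply/negP => /emin; lia.
  rewrite /full /cand; case: (unpickle e') => [im|]; last by exists 0.
  move=> /asboolPn /(closed_predN (clF _))[N HN]; exists N => n Nn.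
  by apply/asboolPn => -[y [/(agree_le Nn)/HN]].
exists (N + e).+1, (idx e); split=> [n /= Nn|]; last first.
  rewrite /idx; move: fe; rewrite /full; case: (unpickle e) => // im /asboolP Fe.
  by apply/EF; exists im.2.
have ce : cand n z e.
  move: fe; rewrite /full /cand; case: (unpickle e) => // im /asboolP Fe.
  by apply/asboolP; exists (zip_seq z.2 (z.1 im.1)).
(* Since [n] exceeds [e], the surviving candidate [e] is in the searched list and [find] does not
   run off its end. *)
congr idx; case: (findP (cand n z) (iota 0 n)) => [/hasPn/(_ e)|k ks ck nck].
  by rewrite mem_iota ce /= => H; have : false by apply: H; lia.
rewrite size_iota in ks.
have := ck 0; rewrite nth_iota // add0n => {}ck.
case: (ltngtP k e) => // [ke|ek].
  by have := HN n _ k ke; rewrite ck => H; have : false by apply: H; lia.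
by have := nck 0 e ek; rewrite nth_iota ?add0n ?ce //; lia.
Qed.

(** * Extracting a witness from a relation that is not F_sigma *)

Section Learnable.
Variables (E : cantor_space -> cantor_space -> Prop) (J : Type).
Variables (D : J -> (nat -> bool * bool * bool) -> Prop).
Hypothesis D_E : forall q, (forall j, D j q) ->
  E (fst_seq (base q)) (snd_seq (base q)).
Hypothesis E_D : forall x y, E x y ->
  exists q, (forall j, D j q) /\ base q = zip_seq x y.

Let Ez z := E (fst_seq z) (snd_seq z).

Definition fsigma_cover (s : seq (bool * bool * bool))
    (F : nat -> (nat -> bool * bool) -> Prop) :=
  [/\ forall m, closed_pred (F m), forall m z, F m z -> Ez z &
      forall q, (forall j, D j q) -> mkseq q (size s) = s ->
        exists m, F m (base q)].

(** The basic open sets to be removed: the projection of their certified triples lies in an F_sigma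
    subset of [E]. *)
Definition small s := exists F, fsigma_cover s F.

Lemma small_nil_learnable : small [::] -> learnable E.
Proof.
move=> [F [clF FE Fcov]]; apply: (fsigma_learnable clF) => x y.
split=> [/E_D[q [Dq <-]]|[m /FE //]]; exact: Fcov.
Qed.

(** One round of removal suffices, without transfinite iteration, since the covers of the countably
    many small sets combine into one. *)
Let core q := (forall j, D j q) /\ forall n, ~ small (mkseq q n).

(** Otherwise the closure of the projection of the core inside [s] would be a closed subset of [E];
    together with the covers of all small [t] it would make [s] small. *)
Lemma closure_core_notE s : ~ small s -> exists b, ~ Ez b /\
  forall k, exists q, [/\ core q, mkseq q (size s) = s & agree k b (base q)].
Proof.
move=> ns; apply: contrapT => nb; apply: ns.
pose cl z :=
  forall k, exists q, [/\ core q, mkseq q (size s) = s & agree k z (base q)].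
have clE z : cl z -> Ez z.
  by move=> clz; apply: contrapT => nE; apply: nb; exists z.
have /choice[Fam HFam] : forall t, exists F, small t -> fsigma_cover t F.
  move=> t; have [[F HF]|nt] := pselect (small t); first by exists F.
  by exists (fun _ _ => False).
(* [Some (t, m')] gives the [m']-th set of the cover of [t], [None] the closure. The conjunct
   [small t] empties the sets for which [Fam] is arbitrary. *)
pose F m z := match unpickle m with
  | Some (Some (t, m')) => small t /\ Fam t m' z
  | Some None => cl z
  | None => False end.
exists F; split.
- rewrite /F => m q; case: (unpickle m) => [[[t m']|]|] Hq.
  + have [p [_ [st _]]] := Hq 0; split=> //.
    have [clF _ _] := HFam t st; apply: clF => n.
    by have [p' [ag [_ Fp]]] := Hq n; exists p'.
  + move=> k; have [p [ag clp]] := Hq k; have [q' [cq sq agq]] := clp k.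
    by exists q'; split=> //; apply: agree_trans agq.
  + by have [p []] := Hq 0.
- rewrite /F => m z; case: (unpickle m) => [[[t m']|]|] //; last exact: clE.
  by move=> [/HFam[_ FE _]] /FE.
move=> q Dq sq; have [cq|ncq] := pselect (forall n, ~ small (mkseq q n)).
  exists (pickle (@None (seq (bool * bool * bool) * nat))).
  by rewrite /F pickleK => k; exists q; split.
have /existsNP[n /contrapT sn] := ncq; have [_ _ cov] := HFam _ sn.
have [|m Fm] := cov q Dq; first by rewrite size_mkseq.
by exists (pickle (Some (mkseq q n, m))); rewrite /F pickleK.
Qed.

(** For each non-small [s], choose a point outside [E] in the closure of the projection of the core
    in [s], and core points whose projections converge to it. All these core points form the family
    [p]; their own prefixes are again non-small, which gives the density. *)
Lemma not_small_witness : ~ small [::] ->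
  exists (p : nat -> nat -> bool * bool * bool) (b : nat -> nat -> bool * bool),
  [/\ forall i j, D j (p i), forall t, ~ Ez (b t) &
    forall i n, exists t, forall k, exists j,
      agree n (p i) (p j) /\ agree k (b t) (base (p j))].
Proof.
move=> n0.
have /choice[B HB] : forall s, exists bQ : (nat -> bool * bool) *
    (nat -> nat -> bool * bool * bool), ~ small s -> ~ Ez bQ.1 /\
    forall k, [/\ core (bQ.2 k), mkseq (bQ.2 k) (size s) = s &
                  agree k bQ.1 (base (bQ.2 k))].
  move=> s; have [ss|ns] := pselect (small s).
    by exists (fun=> (true, true), fun _ _ => (true, true, true)).
  have [b [nb /choice[Q HQ]]] := closure_core_notE ns.
  by exists (b, Q) => _.
(* Enumerates the pairs of a non-small [s] and a precision [k]; all other codes default to [[::]],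
   non-small by [n0]. *)
pose S i := if unpickle i is Some sk then
    let: (s, k) := sk : seq (bool * bool * bool) * nat in
    if `[< small s >] then ([::], 0) else (s, k)
  else ([::], 0).
have nS i : ~ small (S i).1.
  rewrite /S; case: (unpickle i) => [[s k]|] //=.
  by case: ifPn => // /asboolPn.
have SK s k : ~ small s -> S (pickle (s, k)) = (s, k).
  by move=> ns; rewrite /S pickleK asboolF.
exists (fun i => (B (S i).1).2 (S i).2), (fun t => (B (S t).1).1); split.
- by move=> i j; have [_ /(_ (S i).2)[[]]] := HB _ (nS i).
- by move=> t; have [] := HB _ (nS t).
move=> i n; set p := (B _).2 _.
have np : ~ small (mkseq p n) by have [_ /(_ (S i).2)[[]]] := HB _ (nS i).
(* The limit point depends only on the prefix, so its precision component is the dummy 0. *)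
exists (pickle (mkseq p n, 0)) => k; exists (pickle (mkseq p n, k)).
rewrite !SK //=; have [_ /(_ k)[_ pk agk]] := HB _ np.
by split=> //; apply/agree_mkseqP; rewrite -[LHS]pk size_mkseq.
Qed.

End Learnable.

(** * Borel codes and membership certificates *)

(** If [n] codes [s], the argument of [c] is [CodeSeq.code (l :: s)], written out arithmetically. *)
Definition lab (c : cantor_space) n l : bool := c (2 ^ l * n.*2.+1).
Definition child n k := CodeSeq.code (rcons (CodeSeq.decode n) k).
Definition is_node c n := exists l, lab c n l.

Lemma label_code_surj l : exists L, label_code L = l.
Proof.
case: l => [|[|l]]; [by exists Cup | by exists Cap |].
exists (Basic (odd (l %/ 2)) (l %/ 4) (odd l)) => /=; lia.
Qed.

Lemma label_code_inj : injective label_code.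
Proof.
move=> [||[] n []] [||[] n' []] //= H; try lia.
all: by have -> : n = n' by lia.
Qed.

Lemma labE c s l : lab c (CodeSeq.code s) l = c (CodeSeq.code (l :: s)).
Proof. by []. Qed.

Lemma encodeE T s l :
  lab (encode T) (CodeSeq.code s) l = (omap label_code (T s) == Some l).
Proof. by rewrite labE /encode CodeSeq.codeK. Qed.

Lemma lab_encodeP T s L l : T s = Some L ->
  lab (encode T) (CodeSeq.code s) l <-> l = label_code L.
Proof.
by move=> TL; rewrite encodeE TL /=; split=> [/eqP[->]|->].
Qed.

Lemma child_code s k : child (CodeSeq.code s) k = CodeSeq.code (rcons s k).
Proof. by rewrite /child CodeSeq.codeK. Qed.

Lemma is_node_encode T s : is_node (encode T) (CodeSeq.code s) <-> node T s.
Proof.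
rewrite /is_node /node; split=> [[l]|].
  by rewrite encodeE; case: (T s).
case ET: (T s) => [L|//] _; exists (label_code L).
by apply/(lab_encodeP _ ET).
Qed.

(** The arithmetical part of being an encoded Borel code. Position 0 codes the empty sequence, hence
    no pair (node, label); codes above 1 are those of leaf labels. *)
Definition code_ok (c : cantor_space) :=
  [/\ ~ c 0, forall n l l', lab c n l -> lab c n l' -> l = l',
      is_node c 0,
      forall n k, is_node c (child n k) -> is_node c n &
      forall n l, lab c n l -> (1 < l <-> forall k, ~ is_node c (child n k))].

(** Ill-foundedness witnessed by a set rather than by a branch, so that the quantifier ranges over
    elements of Cantor space. *)
Definition is_path c (Q : nat -> bool) :=
  Q 0 /\ forall n, Q n -> is_node c n /\ exists k, Q (child n k).

Lemma nat_codeP n : exists s, n = CodeSeq.code s.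
Proof. by exists (CodeSeq.decode n); rewrite CodeSeq.decodeK. Qed.

(** Repeated choice of a child in [Q] yields an infinite branch. This takes the place of induction
    on the tree. *)
Lemma no_path T (Q : seq nat -> Prop) : borel_code T -> Q [::] ->
  (forall s, Q s -> node T s /\ exists k, Q (rcons s k)) -> False.
Proof.
move=> [_ _ _ wfT] Q0 QS.
have /choice[K HK] : forall s, exists k, Q s -> Q (rcons s k).
  move=> s; have [Qs|nQ] := pselect (Q s); last by exists 0.
  by have [_ [k Qk]] := QS s Qs; exists k.
pose S := fix S m := if m is m'.+1 then rcons (S m') (K (S m')) else [::].
have QSm m : Q (S m) by elim: m => //= m; apply: HK.
have [n] := wfT (fun m => K (S m)); apply.
suff -> : mkseq (fun m => K (S m)) n = S n by case: (QS _ (QSm n)).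
by elim: n => // n IH; rewrite mkseqS IH.
Qed.

Lemma leaf_label_code L : leaf_label L <-> 1 < label_code L.
Proof. by case: L. Qed.

Lemma borel_codeP c :
  (exists T, borel_code T /\ c = encode T) <->
  code_ok c /\ forall Q, ~ is_path c Q.
Proof.
split=> [[T [bT ->]]|[[c0 cfun root prefix lbl] wf]].
  have [root prefix lbl wf] := bT; split; last first.
    move=> Q [Q0 QS].
    apply: (no_path (Q := fun s => Q (CodeSeq.code s)) bT) => // s /QS[ns [k Qk]].
    by split; [apply/is_node_encode | exists k; rewrite -child_code].
  split=> //.
  - move=> n; have [s ->] := nat_codeP n => l l'; rewrite !encodeE.
    by move=> /eqP -> /eqP[].
  - exact/(is_node_encode T [::]).
  - move=> n; have [s ->] := nat_codeP n => k.
    by rewrite child_code !is_node_encode; apply: prefix.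
  - move=> n; have [s ->] := nat_codeP n => l; rewrite encodeE.
    case ET: (T s) => [L|] //= /eqP[<-]; rewrite -leaf_label_code (lbl s L ET).
    split=> [[_ nk] k|nk]; first by rewrite child_code is_node_encode.
    split=> [|k]; first by rewrite /node ET.
    by rewrite -is_node_encode -child_code.
have /choice[T HT] : forall s, exists o, forall l,
    c (CodeSeq.code (l :: s)) = (omap label_code o == Some l).
  move=> s; have [[l cl]|nl] := pselect (is_node c (CodeSeq.code s)).
    have [L EL] := label_code_surj l; exists (Some L) => l' /=.
    rewrite EL; apply/idP/eqP => [cl'|[<-] //].
    by congr Some; apply: cfun cl cl'.
  exists None => l; apply/negbTE/negP => cl; apply: nl.
  by exists l.
have cT : c = encode T.
  apply/funext => m; have [[|k s] ->] := nat_codeP m.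
    by rewrite /encode /=; apply/negbTE/negP.
  by rewrite HT -encodeE.
exists T; split=> //; subst c; split.
- exact/(is_node_encode T [::]).
- by move=> s k; rewrite -!is_node_encode -child_code; apply: prefix.
- move=> s L ET; have := lbl (CodeSeq.code s) (label_code L).
  rewrite encodeE ET eqxx => /(_ isT); rewrite -leaf_label_code => ->.
  rewrite /leaf /node ET; split=> [nk|[_ nk] k].
    by split=> // k; have := nk k; rewrite child_code is_node_encode.
  by rewrite child_code is_node_encode; apply: nk.
- move=> f; apply: contrapT => /forallNP allN.
  (* Conversely, the initial segments of a branch form a path. *)
  apply: (wf (fun n => `[< exists m, n = CodeSeq.code (mkseq f m) >])); split.
    by apply/asboolP; exists 0.
  move=> _ /asboolP[m ->]; split.
    by apply/is_node_encode; apply: contrapT; apply: allN.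
  by exists (f m); apply/asboolP; exists m.+1; rewrite child_code mkseqS.
Qed.

Lemma node_setP T z s L : T s = Some L -> node_set T z s <->
  match L with
  | Cup => exists k, node T (rcons s k) /\ node_set T z (rcons s k)
  | Cap => forall k, node T (rcons s k) -> node_set T z (rcons s k)
  | Basic i n b => subbasic i n b z
  end.
Proof.
move=> TL; split.
  move=> H; case: H TL => {}s.
  - by move=> i n b -> H [<-].
  - by move=> k -> nk sk [<-]; exists k.
  - by move=> -> H [<-].
case: L TL => [||i n b] TL; [move=> [k [nk sk]]|move=> H|move=> H].
- exact: node_set_cup nk sk.
- exact: node_set_cap.
- exact: node_set_basic TL H.
Qed.

(* The k-th condition at the node n for v to be a set of nodes whose sets contain
   (x, y) (if pol) or do not contain (x, y) (if ~~ pol). *)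
Definition cert_at (pol : bool) c (x y v : nat -> bool) n k :=
  v 0 /\ (v n ->
  [/\ lab c n (~~ pol) -> exists k', is_node c (child n k') /\ v (child n k'),
      lab c n pol -> is_node c (child n k) -> v (child n k) &
      forall i b : bool, lab c n (2 + (4 * k + 2 * i + b)) ->
        (if i then y k else x k) = (b == pol)]).

Definition cert pol c x y v := forall n k, cert_at pol c x y v n k.

(** If a certificate lied at the root, the nodes in it at which it lies would contradict
    well-foundedness. Conversely, collect all sequences with the right status. As numbers, [~~ pol]
    and [pol] are the codes of [Cup] and [Cap] when [pol] is true, and are swapped otherwise, by De
    Morgan duality. *)
Lemma certP T (x y : cantor_space) pol : borel_code T ->
  (exists v, cert pol (encode T) x y v) <->
  (if pol then coded_rel T x y else ~ coded_rel T x y).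
Proof.
move=> bT; split=> [[v cv]|Exy].
  have v0 : v 0 by case: (cv 0 0).
  suff H : ~ (if pol then ~ coded_rel T x y else coded_rel T x y).
    by case: pol cv H => _ // /contrapT.
  move=> Exy; apply: (no_path (Q := fun s => [/\ node T s, v (CodeSeq.code s) &
    if pol then ~ node_set T (x, y) s else node_set T (x, y) s]) bT).
    by split=> //; apply: borel_code_root bT.
  move=> s [ns vs]; split=> //; rewrite /node in ns.
  case ET: (T s) ns Exy => [L|//] _ Exy.
  have cs k : [/\ lab (encode T) (CodeSeq.code s) (~~ pol) ->
        exists k, node T (rcons s k) /\ v (CodeSeq.code (rcons s k)),
      lab (encode T) (CodeSeq.code s) pol ->
        node T (rcons s k) -> v (CodeSeq.code (rcons s k)) &
      forall i b : bool,
        lab (encode T) (CodeSeq.code s) (label_code (Basic i k b)) ->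
        (if i then y k else x k) = (b == pol)].
    have [_ /(_ vs)[H1 H2 H3]] := cv (CodeSeq.code s) k; split=> //.
      move=> /H1[k' [nk vk]]; exists k'.
      by rewrite -is_node_encode -child_code.
    by move=> /H2 H; rewrite -is_node_encode -child_code.
  case: L ET => [||i n b] ET; case: pol cs cv Exy p => cs cv Exy;
    rewrite (node_setP _ ET) => Hs.
  - have [/(_ ((lab_encodeP _ ET).2 erefl))[k [nk vk]] _ _] := cs 0.
    by exists k; split=> // sk; apply: Hs; exists k.
  - have [k [nk sk]] := Hs; exists k; split=> //.
    by have [_ /(_ ((lab_encodeP _ ET).2 erefl)) H _] := cs k; apply: H.
  - have /existsNP[k /not_implyP[nk sk]] := Hs; exists k; split=> //.
    by have [_ /(_ ((lab_encodeP _ ET).2 erefl)) H _] := cs k; apply: H.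
  - have [/(_ ((lab_encodeP _ ET).2 erefl))[k [nk vk]] _ _] := cs 0.
    by exists k; split=> //; apply: Hs.
  - have [_ _ /(_ i b ((lab_encodeP _ ET).2 erefl))] := cs n.
    by move: Hs; rewrite /subbasic /=; case: i {ET} b {cs cv} => -[] //; case: (_ n).
  - have [_ _ /(_ i b ((lab_encodeP _ ET).2 erefl))] := cs n.
    by move: Hs; rewrite /subbasic /=; case: i {ET} b {cs cv} => -[] //; case: (_ n).
exists (fun n => `[< node_set T (x, y) (CodeSeq.decode n) >] == pol) => n k.
split; first by rewrite /CodeSeq.decode; case: pol Exy => H; apply/eqP/asboolP.
have [s ->] := nat_codeP n; rewrite CodeSeq.codeK => /eqP vs.
have [ns|nns] := pselect (node T s); last first.
  have nl l : ~ lab (encode T) (CodeSeq.code s) l.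
    by move=> ls; apply/nns/is_node_encode; exists l.
  by split=> [/nl|/nl|i b /nl].
rewrite /node in ns; case ET: (T s) ns => [L|//] _.
have nodeE k' : is_node (encode T) (child (CodeSeq.code s) k') <-> node T (rcons s k').
  by rewrite child_code is_node_encode.
have vE k' : (`[< node_set T (x, y)
      (CodeSeq.decode (child (CodeSeq.code s) k')) >] == pol) <->
    (if pol then node_set T (x, y) (rcons s k')
     else ~ node_set T (x, y) (rcons s k')).
  by rewrite child_code CodeSeq.codeK; case: pol {Exy vs};
    split=> [/eqP/asboolP|H]//; apply/eqP/asboolP.
have {}vs : if pol then node_set T (x, y) s else ~ node_set T (x, y) s.
  by case: pol {Exy vE} vs => /asboolP.
split.
- rewrite (lab_encodeP _ ET); case: pol {Exy} vs vE => vs vE;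
    case: L ET => // ET _; move: vs; rewrite (node_setP _ ET).
    by move=> [k' [nk sk]]; exists k'; split; [apply/nodeE | apply/vE].
  move=> /existsNP[k' /not_implyP[nk sk]].
  by exists k'; split; [apply/nodeE | apply/vE].
- rewrite (lab_encodeP _ ET) nodeE vE; case: pol {Exy} vs {vE} => vs;
    case: L ET => // ET _ nk; move: vs; rewrite (node_setP _ ET); first exact.
  by move=> nH sk; apply: nH; exists k.
move=> i b; rewrite encodeE ET => /eqP[EL].
have {EL} EL : L = Basic i k b by apply: label_code_inj.
rewrite {}EL in ET.
case: pol {Exy vE} vs; rewrite (node_setP _ ET) /subbasic /=.
  by case: i {ET} => ->; rewrite eqb_id.
by case: i {ET}; case: b; case: (_ k).
Qed.

(** Only the clause for unions searches without bound; it stays true once the coordinate of one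
    chosen child is fixed. *)
Lemma open_cert_at c nk :
  open_pred (fun p => cert_at true c (fst_seq (base p)) (snd_seq (base p))
    (fun m => (p m).2) nk.1 nk.2).
Proof.
case: nk => n k p [p0 pn] /=.
have [N HN] : exists N, (p n).2 -> lab c n 0 -> exists k',
    [/\ child n k' < N, is_node c (child n k') & (p (child n k')).2].
  have [/andP[pn2 ln]|nl] := boolP ((p n).2 && lab c n 0); last first.
    by exists 0 => pn2 ln; rewrite pn2 ln in nl.
  have [/(_ ln)[k' [nk' vk']] _ _] := pn pn2.
  by exists (child n k').+1 => _ _; exists k'.
exists (N + n + k + child n k).+1 => q ag.
rewrite /cert_at /fst_seq /snd_seq /base -!ag; try lia.
split=> // pn2; have [_ H2 H3] := pn pn2; split=> //.
move=> /(HN pn2)[k' [lt nk' vk']]; exists k'.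
by rewrite -ag //; lia.
Qed.

(** * The matrix of the Pi^1_1 definition *)

(** A polynomial, hence expressible by terms; it is injective because the values lie between
    consecutive squares. It need not be onto. *)
Definition pr a b := (a + b) * (a + b) + a.

Lemma pr_inj a b a' b' : pr a b = pr a' b' -> a = a' /\ b = b'.
Proof.
rewrite /pr => H; have ab : a + b = a' + b' by nia.
by split; nia.
Qed.

Definition unsec (F : nat -> nat -> bool) : cantor_space :=
  fun m => `[< exists i n, m = pr i n /\ F i n >].

Lemma unsecE F i n : unsec F (pr i n) = F i n.
Proof.
by apply/asboolP/idP => [[i' [n' [/pr_inj[-> ->]]]]|Fin] //; exists i, n.
Qed.

Definition sec (A : cantor_space) i : cantor_space := fun n => A (pr i n).

(** Certificates of both polarities turn each failure of an axiom into an existential statement over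
    sets with an arithmetical matrix. *)
Definition equiv_violation c (x y z v1 v2 v3 : cantor_space) :=
  [\/ cert false c x x v1,
      cert true c x y v1 /\ cert false c y x v2 |
      [/\ cert true c x y v1, cert true c y z v2 & cert false c x z v3]].

(** The sections of [px], [py], [pv] are the certified triples p_i; those of [qx], [qy] are the
    pairs b_t, with [qv] certifying that they are not in the relation. *)
Definition fsigma_violation c (px py pv qx qy qv : cantor_space) :=
  [/\ forall i, cert true c (sec px i) (sec py i) (sec pv i),
      forall t, cert false c (sec qx t) (sec qy t) (sec qv t) &
      forall i n, exists t, forall k, exists j,
        (forall m, m < n -> [/\ px (pr i m) = px (pr j m),
           py (pr i m) = py (pr j m) & pv (pr i m) = pv (pr j m)]) /\
        (forall m, m < k ->
           qx (pr t m) = px (pr j m) /\ qy (pr t m) = py (pr j m))].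

(** The conjuncts can share their set variables because universal quantifiers distribute over
    conjunction. *)
Definition pi11_matrix c (y0 y1 y2 y3 y4 y5 : cantor_space) :=
  [/\ code_ok c, ~ is_path c y0, ~ equiv_violation c y0 y1 y2 y3 y4 y5 &
      ~ fsigma_violation c y0 y1 y2 y3 y4 y5].

(** * Correctness of the matrix *)

Lemma coded_rel_cert T x y : borel_code T ->
  coded_rel T x y <-> exists v, cert true (encode T) x y v.
Proof. by move=> bT; rewrite (certP _ _ true bT). Qed.

Lemma not_coded_rel_cert T x y : borel_code T ->
  ~ coded_rel T x y <-> exists v, cert false (encode T) x y v.
Proof. by move=> bT; rewrite (certP _ _ false bT). Qed.

Lemma equiv_violationP T : borel_code T ->
  Equivalence (coded_rel T) <->
  forall x y z v1 v2 v3, ~ equiv_violation (encode T) x y z v1 v2 v3.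
Proof.
move=> bT; split=> [[Er Es Et] x y z v1 v2 v3 [Cx|[Cxy Cyx]|[Cxy Cyz Cxz]]|H].
- by apply: (not_coded_rel_cert x x bT).2 (Er x); exists v1.
- apply: (not_coded_rel_cert y x bT).2; first by exists v2.
  by apply/Es/(coded_rel_cert _ _ bT); exists v1.
- apply: (not_coded_rel_cert x z bT).2; first by exists v3.
  by apply: (Et x y z); apply/(coded_rel_cert _ _ bT); [exists v1 | exists v2].
split.
- move=> x; apply: contrapT => /(not_coded_rel_cert _ _ bT)[v Cv].
  by apply: (H x x x v v v); apply: Or31.
- move=> x y /(coded_rel_cert _ _ bT)[v Cv].
  apply: contrapT => /(not_coded_rel_cert _ _ bT)[v' Cv'].
  by apply: (H x y y v v' v'); apply: Or32.
- move=> x y z /(coded_rel_cert _ _ bT)[v Cv] /(coded_rel_cert _ _ bT)[v' Cv'].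
  apply: contrapT => /(not_coded_rel_cert _ _ bT)[v'' Cv''].
  by apply: (H x y z v v' v''); apply: Or33.
Qed.

(** The conditions [D] are the clauses of a positive certificate, indexed by pairs. A violation then
    feeds [witness_not_learnable]; if there is none, [[::]] must be small, for otherwise the witness
    from [not_small_witness] could be packed into six sets. *)
Lemma fsigma_violationP T : borel_code T -> Equivalence (coded_rel T) ->
  learnable (coded_rel T) <->
  forall px py pv qx qy qv, ~ fsigma_violation (encode T) px py pv qx qy qv.
Proof.
move=> bT eqT.
pose D nk (p : nat -> bool * bool * bool) := cert_at true (encode T)
  (fst_seq (base p)) (snd_seq (base p)) (fun m => (p m).2) nk.1 nk.2.
have D_E q : (forall j, D j q) ->
    coded_rel T (fst_seq (base q)) (snd_seq (base q)).
  move=> Dq; apply/(coded_rel_cert _ _ bT); exists (fun m => (q m).2) => n k.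
  exact: (Dq (n, k)).
have E_D x y : coded_rel T x y ->
    exists q, (forall j, D j q) /\ base q = zip_seq x y.
  move=> /(coded_rel_cert _ _ bT)[v Cv]; exists (zip_seq (zip_seq x y) v).
  by split=> // -[n k]; apply: Cv.
split=> [lT px py pv qx qy qv [Cp Cb lim]|H].
  pose p i m := (px (pr i m), py (pr i m), pv (pr i m)).
  pose b t m := (qx (pr t m), qy (pr t m)).
  apply: (@witness_not_learnable _ _ D p b eqT _ D_E) lT.
  - exact: open_cert_at.
  - by move=> i [n k]; apply: Cp.
  - move=> t; apply/(not_coded_rel_cert _ _ bT); exists (sec qv t); exact: Cb.
  move=> i n; have [t Ht] := lim i n; exists t => k; have [j [H1 H2]] := Ht k.
  exists j; split=> m mn; rewrite /p /b /base.
    by have [-> -> ->] := H1 m mn.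
  by have [-> ->] := H2 m mn.
have [sm|/(not_small_witness)[p [b [Dp nb lim]]]] :=
    pselect (small (coded_rel T) D [::]); first exact: small_nil_learnable E_D sm.
have /choice[v Cv] : forall t, exists v : cantor_space,
    cert false (encode T) (fst_seq (b t)) (snd_seq (b t)) v.
  by move=> t; apply/(not_coded_rel_cert _ _ bT)/nb.
have secE F i : sec (unsec F) i = F i by apply/funext => n; apply: unsecE.
case: (H (unsec (fun i m => (p i m).1.1)) (unsec (fun i m => (p i m).1.2))
  (unsec (fun i m => (p i m).2)) (unsec (fun t m => (b t m).1))
  (unsec (fun t m => (b t m).2)) (unsec v)); split.
- by move=> i n k; rewrite !secE; apply: (Dp i (n, k)).
- by move=> t; rewrite !secE; apply: Cv.
move=> i n; have [t Ht] := lim i n; exists t => k; have [j [H1 H2]] := Ht k.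
exists j; split=> m mn; rewrite !unsecE ?H1 ?H2 //.
Qed.

Lemma matrixP c :
  (exists T : labeled_tree, [/\ borel_code T, c = encode T,
     Equivalence (coded_rel T) & learnable (coded_rel T)]) <->
  forall y0 y1 y2 y3 y4 y5, pi11_matrix c y0 y1 y2 y3 y4 y5.
Proof.
split=> [[T [bT -> eqT lT]] y0 y1 y2 y3 y4 y5|H].
  have [|ok path] := (borel_codeP (encode T)).1; first by exists T.
  split=> //; first exact: (equiv_violationP bT).1.
  exact: (fsigma_violationP bT eqT).1.
have [|T [bT cT]] := (borel_codeP c).2.
  (* The code [c] is a dummy value for the remaining set variables. *)
  by split=> [|Q]; [case: (H c c c c c c) | case: (H Q c c c c c)].
subst c; have eqT : Equivalence (coded_rel T).
  by apply/(equiv_violationP bT) => x y z v1 v2 v3; case: (H x y z v1 v2 v3).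
exists T; split=> //; apply/(fsigma_violationP bT eqT) => px py pv qx qy qv.
by case: (H px py pv qx qy qv).
Qed.

(** * Arithmetical definability *)

(** With functions as environments, renaming variables is composition. *)
Fixpoint feval (e : nat -> nat) (t : term) : nat :=
  match t with
  | TVar i => e i
  | TZero => 0
  | TSucc t => (feval e t).+1
  | TAdd t u => feval e t + feval e u
  | TMul t u => feval e t * feval e u
  end.

Fixpoint fsat (X : nat -> cantor_space) (e : nat -> nat) (phi : arith_formula) :=
  match phi with
  | FEq t u => feval e t = feval e u
  | FLt t u => feval e t < feval e u
  | FIn t i => X i (feval e t)
  | FNot phi => ~ fsat X e phi
  | FAnd phi psi => fsat X e phi /\ fsat X e psi
  | FAll phi => forall n, fsat X (cons_seq n e) phi
  end.

Lemma evalE e t : Defs.eval e t = feval (nth 0 e) t.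
Proof. by elim: t => //= [t ->|t -> u ->|t -> u ->]. Qed.

Lemma satE X e phi : sat X e phi <-> fsat (nth (fun=> false) X) (nth 0 e) phi.
Proof.
elim: phi e => //= [t u|t u|t i|phi IH|phi IH psi IH'|phi IH] e;
  rewrite ?evalE ?IH ?IH' //.
have nthE n : nth 0 (n :: e) = cons_seq n (nth 0 e) by apply/funext => -[].
by split=> H n; have := H n; rewrite IH nthE.
Qed.

Section Definable.
Variable Adm : (nat -> cantor_space) -> Prop.

(** Correctness is required only under [Adm], so that a formula may presuppose that certain set
    variables hold the graphs of given functions. *)
Definition definable (P : (nat -> cantor_space) -> (nat -> nat) -> Prop) :=
  exists phi, forall X e, Adm X -> fsat X e phi <-> P X e.

Lemma def_ext P Q : (forall X e, Adm X -> P X e <-> Q X e) ->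
  definable P -> definable Q.
Proof.
by move=> PQ [phi H]; exists phi => X e aX; rewrite H // PQ.
Qed.

Lemma def_not P : definable P -> definable (fun X e => ~ P X e).
Proof. by move=> [phi H]; exists (FNot phi) => X e aX /=; rewrite H. Qed.

Lemma def_and P Q : definable P -> definable Q ->
  definable (fun X e => P X e /\ Q X e).
Proof.
by move=> [phi H] [psi H']; exists (FAnd phi psi) => X e aX /=; rewrite H // H'.
Qed.

Lemma def_all (P : _ -> _ -> nat -> Prop) :
  definable (fun X e => P X (fun i => e i.+1) (e 0)) ->
  definable (fun X e => forall n, P X e n).
Proof.
move=> [phi H]; exists (FAll phi) => X e aX /=.
by split=> HP n; have := HP n; rewrite H.
Qed.

Lemma def_ex (P : _ -> _ -> nat -> Prop) :
  definable (fun X e => P X (fun i => e i.+1) (e 0)) ->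
  definable (fun X e => exists n, P X e n).
Proof.
move=> dP; apply: (@def_ext (fun X e => ~ forall n, ~ P X e n)).
  move=> X e _; split=> [/existsNP[n /contrapT]|[n Pn]]; first by exists n.
  by move=> /(_ n).
exact/def_not/def_all/def_not.
Qed.

Lemma def_imp P Q : definable P -> definable Q ->
  definable (fun X e => P X e -> Q X e).
Proof.
move=> dP dQ; apply: (@def_ext (fun X e => ~ (P X e /\ ~ Q X e))).
  move=> X e _; split=> [H p|H [p]]; last by apply; apply: H.
  by apply: contrapT => nq; apply: H.
by apply: def_not; apply: def_and => //; apply: def_not.
Qed.

Lemma def_iff P Q : definable P -> definable Q ->
  definable (fun X e => P X e <-> Q X e).
Proof. by move=> dP dQ; apply: def_and; apply: def_imp. Qed.

Lemma def_or P Q : definable P -> definable Q ->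
  definable (fun X e => P X e \/ Q X e).
Proof.
move=> dP dQ; apply: (@def_ext (fun X e => ~ P X e -> Q X e)).
  move=> X e _; split=> [H|[p np|q _] //].
  by have [p|/H q] := pselect (P X e); [left | right].
by apply: def_imp => //; apply: def_not.
Qed.

Lemma def_and3 P Q R : definable P -> definable Q -> definable R ->
  definable (fun X e => [/\ P X e, Q X e & R X e]).
Proof.
move=> dP dQ dR; apply: (@def_ext (fun X e => P X e /\ Q X e /\ R X e)).
  by move=> X e _; split=> [[? []]|[]].
by apply: def_and => //; apply: def_and.
Qed.

Lemma def_and4 P Q R S :
  definable P -> definable Q -> definable R -> definable S ->
  definable (fun X e => [/\ P X e, Q X e, R X e & S X e]).
Proof.
move=> dP dQ dR dS.
apply: (@def_ext (fun X e => P X e /\ [/\ Q X e, R X e & S X e])).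
  by move=> X e _; split=> [[? []]|[]].
by apply: def_and => //; apply: def_and3.
Qed.

Lemma def_and5 P Q R S U :
  definable P -> definable Q -> definable R -> definable S -> definable U ->
  definable (fun X e => [/\ P X e, Q X e, R X e, S X e & U X e]).
Proof.
move=> dP dQ dR dS dU.
apply: (@def_ext (fun X e => P X e /\ [/\ Q X e, R X e, S X e & U X e])).
  by move=> X e _; split=> [[? []]|[]].
by apply: def_and => //; apply: def_and4.
Qed.

Lemma def_or3 P Q R : definable P -> definable Q -> definable R ->
  definable (fun X e => [\/ P X e, Q X e | R X e]).
Proof.
move=> dP dQ dR; apply: (@def_ext (fun X e => P X e \/ Q X e \/ R X e)).
  move=> X e _; split=> [[|[]]|[]].
  - exact: Or31.
  - exact: Or32.
  - exact: Or33.
  - by left.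
  - by right; left.
  - by right; right.
by do 2?apply: def_or.
Qed.

Lemma def_allb (P : _ -> _ -> bool -> Prop) :
  definable (fun X e => P X e true) -> definable (fun X e => P X e false) ->
  definable (fun X e => forall b, P X e b).
Proof.
move=> dT dF; apply: (@def_ext (fun X e => P X e true /\ P X e false)).
  by move=> X e _; split=> [[? ?] []|H].
exact: def_and.
Qed.

Lemma def_eqb (p q : _ -> _ -> bool) :
  definable (fun X e => p X e) -> definable (fun X e => q X e) ->
  definable (fun X e => p X e = q X e).
Proof.
move=> dp dq; apply: (@def_ext (fun X e => p X e <-> q X e)).
  by move=> X e _; split=> [H|->//]; apply/idP/idP => /H.
exact: def_iff.
Qed.

Lemma def_cstb (b : bool) : definable (fun X e => b).
Proof.
by case: b; [exists (FEq TZero TZero) | exists (FLt TZero TZero)].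
Qed.

(* Quantifying over all renamings of the variables builds in weakening. *)
Definition definable_fun (f : (nat -> cantor_space) -> (nat -> nat) -> nat) :=
  forall j r, definable (fun X e => e j = f X (fun i => e (r i))).

Lemma def_var_in i j : definable (fun X e => X i (e j)).
Proof. by exists (FIn (TVar j) i). Qed.

(** The value of [f] is named by a quantified variable, since [f] need not be a term. *)
Lemma def_subst (P : _ -> nat -> Prop) f :
  (forall j, definable (fun X e => P X (e j))) ->
  definable_fun f -> definable (fun X e => P X (f X e)).
Proof.
move=> dP df; apply: (@def_ext (fun X e => exists m, m = f X e /\ P X m)).
  by move=> X e _; split=> [[m [->]]|Pf] //; exists (f X e).
by apply: def_ex; apply: def_and; [apply: df | apply: dP].
Qed.

Lemma def_subst2 (P : _ -> nat -> nat -> Prop) f g :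
  (forall i j, definable (fun X e => P X (e i) (e j))) ->
  definable_fun f -> definable_fun g ->
  definable (fun X e => P X (f X e) (g X e)).
Proof.
move=> dP df dg; apply: (@def_ext (fun X e => exists m n,
    (m = f X e /\ n = g X e) /\ P X m n)).
  by move=> X e _; split=> [[m [n [[-> ->]]]]|Pf] //; exists (f X e), (g X e).
apply: def_ex; apply: def_ex; apply: def_and; last exact: dP.
by apply: def_and; [apply: (df 1) | apply: (dg 0)].
Qed.

Lemma def_in i f : definable_fun f -> definable (fun X e => X i (f X e)).
Proof. by apply: (@def_subst (fun X n => X i n)) => j; apply: def_var_in. Qed.

Lemma def_eq f g : definable_fun f -> definable_fun g ->
  definable (fun X e => f X e = g X e).
Proof.
apply: (@def_subst2 (fun X m n => m = n)) => i j.
by exists (FEq (TVar i) (TVar j)).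
Qed.

Lemma def_lt f g : definable_fun f -> definable_fun g ->
  definable (fun X e => f X e < g X e).
Proof.
apply: (@def_subst2 (fun X m n => m < n)) => i j.
by exists (FLt (TVar i) (TVar j)).
Qed.

Lemma dfun_var i : definable_fun (fun X e => e i).
Proof. by move=> j r; exists (FEq (TVar j) (TVar (r i))). Qed.

Lemma dfun_cst n : definable_fun (fun X e => n).
Proof.
move=> j r; exists (FEq (TVar j) (iter n TSucc TZero)) => X e _ /=.
suff -> : feval e (iter n TSucc TZero) = n by [].
by elim: n => //= n ->.
Qed.

Lemma dfun_app2 (op : nat -> nat -> nat) f g :
  (forall i j k, definable (fun X e => e k = op (e i) (e j))) ->
  definable_fun f -> definable_fun g ->
  definable_fun (fun X e => op (f X e) (g X e)).
Proof.
move=> dop df dg j r.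
apply: (@def_ext (fun X e => exists m n, (m = f X (fun i => e (r i)) /\
    n = g X (fun i => e (r i))) /\ e j = op m n)).
  move=> X e _; split=> [[m [n [[-> ->]]]] //|ej].
  by exists (f X (fun i => e (r i))), (g X (fun i => e (r i))).
(* Under the two new quantifiers [m] is variable 1, [n] is variable 0, and older variables move up
   by two. *)
apply: def_ex; apply: def_ex; apply: def_and; last exact: (dop 1 0 j.+2).
apply: def_and; first exact: (df 1 (fun i => (r i).+2)).
exact: (dg 0 (fun i => (r i).+2)).
Qed.

Lemma dfun_add f g : definable_fun f -> definable_fun g ->
  definable_fun (fun X e => f X e + g X e).
Proof.
by apply: dfun_app2 => i j k; exists (FEq (TVar k) (TAdd (TVar i) (TVar j))).
Qed.

Lemma dfun_mul f g : definable_fun f -> definable_fun g ->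
  definable_fun (fun X e => f X e * g X e).
Proof.
by apply: dfun_app2 => i j k; exists (FEq (TVar k) (TMul (TVar i) (TVar j))).
Qed.

Lemma dfun_ext f g : (forall X e, f X e = g X e) ->
  definable_fun f -> definable_fun g.
Proof. by move=> fg df j r; apply: def_ext (df j r) => X e _; rewrite fg. Qed.

Lemma dfun_succ f : definable_fun f -> definable_fun (fun X e => (f X e).+1).
Proof.
move=> df; apply: (@dfun_ext (fun X e => f X e + 1)) => [X e|].
  by rewrite addn1.
by apply: dfun_add => //; apply: dfun_cst.
Qed.

Lemma dfun_double f : definable_fun f -> definable_fun (fun X e => (f X e).*2).
Proof.
move=> df; apply: (@dfun_ext (fun X e => f X e + f X e)) => [X e|].
  by rewrite addnn.
exact: dfun_add.
Qed.

Lemma dfun_pr f g : definable_fun f -> definable_fun g ->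
  definable_fun (fun X e => pr (f X e) (g X e)).
Proof.
by move=> df dg; apply: dfun_add => //; apply: dfun_mul; apply: dfun_add.
Qed.

End Definable.

(* A set variable can name a recursive function because its graph is the unique
   solution of an arithmetical condition; this spares a Goedel beta function. *)
Definition graphs (X : nat -> cantor_space) :=
  (forall n v, X 1 (pr n v) <-> v = 2 ^ n) /\
  (forall n k m, X 2 (pr (pr n k) m) <-> m = child n k).

(** Recursion equations for powers of 2 and for [child], the latter following the code
    [2 ^ a * n.*2.+1] of a sequence with head [a]. *)
Definition graphs_spec (X : nat -> cantor_space) :=
  [/\ X 1 (pr 0 1), forall n v, X 1 (pr n v) -> X 1 (pr n.+1 v.*2) &
      forall n v v', X 1 (pr n v) -> X 1 (pr n v') -> v = v'] /\
  [/\ forall k v, X 1 (pr k v) -> X 2 (pr (pr 0 k) v),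
      forall a w n k m, X 1 (pr a w) -> X 2 (pr (pr n k) m) ->
        X 2 (pr (pr (w * n.*2.+1) k) (w * m.*2.+1)) &
      forall n k m m', X 2 (pr (pr n k) m) -> X 2 (pr (pr n k) m') -> m = m'].

(** By induction, the closure clauses put every correct value into the graph; single-valuedness
    excludes all others. *)
Lemma graphsP X : graphs X <-> graphs_spec X.
Proof.
split=> [[G R]|[[G0 GS Gf] [R0 RS Rf]]].
  have G' n v : X 1 (pr n v) = (v == 2 ^ n) by apply/idP/eqP => /G.
  have R' n k m : X 2 (pr (pr n k) m) = (m == child n k).
    by apply/idP/eqP => /R.
  split; split.
  - by rewrite G'.
  - by move=> n v; rewrite !G' => /eqP ->; rewrite expnS mul2n.
  - by move=> n v v'; rewrite !G' => /eqP -> /eqP ->.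
  - by move=> k v; rewrite G' R' => /eqP ->; rewrite /child /= muln1.
  - move=> a w n k m; rewrite G' !R' => /eqP -> /eqP ->.
    have [s ->] := nat_codeP n.
    by rewrite child_code (child_code (a :: s)).
  - by move=> n k m m'; rewrite !R' => /eqP -> /eqP ->.
have G n v : X 1 (pr n v) <-> v = 2 ^ n.
  have Gn : X 1 (pr n (2 ^ n)).
    by elim: n => // n IH; rewrite expnS mul2n; apply: GS.
  by split=> [/Gf/(_ Gn)|->].
split=> // n k m.
have Rn : X 2 (pr (pr n k) (child n k)).
  have [s ->] := nat_codeP n; rewrite child_code.
  elim: s => [|a s IH]; first by apply: R0; rewrite /= muln1 G.
  by apply: (RS a) => //; apply/G.
by split=> [/Rf/(_ Rn)|->].
Qed.

Lemma dfun_exp2 f : definable_fun graphs f ->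
  definable_fun graphs (fun X e => 2 ^ (f X e)).
Proof.
move=> df; apply: (@dfun_app2 _ (fun a _ => 2 ^ a) f f) => // i j k.
apply: (@def_ext _ (fun X e => X 1 (pr (e i) (e k)))) => [X e []//|].
by apply: def_in; apply: dfun_pr; apply: dfun_var.
Qed.

Lemma dfun_child f g : definable_fun graphs f -> definable_fun graphs g ->
  definable_fun graphs (fun X e => child (f X e) (g X e)).
Proof.
apply: dfun_app2 => i j k.
apply: (@def_ext _ (fun X e => X 2 (pr (pr (e i) (e j)) (e k)))) => [X e []//|].
by apply: def_in; do ?[apply: dfun_pr]; apply: dfun_var.
Qed.

Ltac dfun := repeat first
  [ apply: dfun_cst | apply: dfun_var | apply: dfun_pr | apply: dfun_child
  | apply: dfun_exp2 | apply: dfun_double | apply: dfun_succ | apply: dfun_mul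
  | apply: dfun_add ].

Ltac def := repeat (cbv beta iota; first
  [ apply: def_cstb | apply: def_and5 | apply: def_and4 | apply: def_and3
  | apply: def_and
  | apply: def_or3 | apply: def_iff | apply: def_not | apply: def_all
  | apply: def_ex | apply: def_allb | apply: def_imp
  | apply: def_in; solve [dfun] | apply: def_lt; solve [dfun]
  | apply: def_eqb | apply: def_eq; solve [dfun] ]).

(** There is no circularity: [graphs_spec] mentions only polynomial terms, so no assumption on [X]
    is needed. *)
Lemma definable_graphs : definable (fun=> True) (fun X e => graphs X).
Proof.
apply: (@def_ext _ (fun X e => graphs_spec X)) => [X e _|].
  by rewrite graphsP.
rewrite /graphs_spec; def.
Qed.

(** Set variable 0 is the code, 1 and 2 are the graphs, and 3 to 8 are the arguments of the
    matrix. *)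
Lemma definable_matrix : definable graphs (fun X e =>
  pi11_matrix (X 0) (X 3) (X 4) (X 5) (X 6) (X 7) (X 8)).
Proof.
rewrite /pi11_matrix /code_ok /is_path /equiv_violation /fsigma_violation /cert.
rewrite /cert_at /sec /is_node /lab; def.
Qed.

(** * Assembly of the Pi^1_1 formula *)

Lemma graphs_exist : exists G R : cantor_space, forall X,
  X 1 = G -> X 2 = R -> graphs X.
Proof.
exists (unsec (fun n v => v == 2 ^ n)).
exists (unsec (fun nk m => `[< exists n k, nk = pr n k /\ m = child n k >])).
move=> X X1 X2; split=> [n v|n k m].
  by rewrite X1 unsecE; split=> [/eqP|->].
rewrite X2 unsecE; split=> [/asboolP[n' [k' [/pr_inj[-> ->]]]] //|->].
by apply/asboolP; exists n, k.
Qed.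

Theorem theorem3p2 :
  Pi11 [set c : cantor_space | exists T : labeled_tree,
    [/\ borel_code T, c = encode T,
        Equivalence (coded_rel T) & learnable (coded_rel T)]].
Proof.
have [gr Hgr] := definable_graphs; have [mat Hmat] := definable_matrix.
(* Two graphs and six arguments make 8 set variables; the formula says that [gr] implies [mat]. *)
exists 8, (FNot (FAnd gr (FNot mat))) => c /=.
rewrite matrixP; split=> [H X|H y0 y1 y2 y3 y4 y5].
  rewrite !satE Hgr // => -[gX]; apply; apply/Hmat => //; exact: H.
(* Taking the true graphs for the first two variables keeps the implication from being vacuous. *)
have [G [R GR]] := graphs_exist.
have := H [tuple G; R; y0; y1; y2; y3; y4; y5].
rewrite !satE Hgr // => nH.
set X := nth _ _ in nH.
have gX : graphs X by apply: GR.
have /(Hmat X (nth 0 [::]) gX) // : fsat X (nth 0 [::]) mat.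
by apply: contrapT => nm; apply: nH.
Qed.
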